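(* Let $\pi$ be a probability distribution on $(\mathsf{X},\mathscr{X})$ and $T_{1},T_{-1}$ sub-stochastic kernels on $\mathsf{X}$ with $\pi({\rm d}x)T_{1}(x,{\rm d}y)=\pi({\rm d}y)T_{-1}(y,{\rm d}x)$. Let $E=\mathsf{X}\times\{-1,1\}$, $\mu({\rm d}(x,v))=\tfrac12\pi({\rm d}x)\mathbb{I}\{v\in\{-1,1\}\}$ and $Qf(x,v)=f(x,-v)$. Call a pair of functions $\rho_{1,-1},\rho_{-1,1}:\mathsf{X}\to\mathbb{R}$ a switching rate if for all $(x,v)\in E$, $0\leq\rho_{v,-v}(x)\leq1-T_{v}(x,\mathsf{X})$ and $\rho_{v,-v}(x)-\rho_{-v,v}(x)=T_{-v}(x,\mathsf{X})-T_{v}(x,\mathsf{X})$, and for such $\rho$ define \[P^{{\rm lifted},\rho}\big((x,v);{\rm d}(y,w)\big)=\mathbb{I}\{w=v\}\big[T_{v}(x,{\rm d}y)+\delta_{x}({\rm d}y)\big(1-T_{v}(x,\mathsf{X})-\rho_{v,-v}(x)\big)\big]+\mathbb{I}\{w=-v\}\delta_{x}({\rm d}y)\rho_{v,-v}(x).\] Let $\tilde\rho_{v,-v}(x)=\max\{0,T_{-v}(x,\mathsf{X})-T_{v}(x,\mathsf{X})\}$. Then for any switching rate $\rho$, any $f\in L^{2}(\mu)$ with $Qf=f$ and any $\lambda\in[0,1)$, \[{\rm var}_{\lambda}(f,P^{{\rm lifted},\tilde\rho})\leq{\rm var}_{\lambda}(f,P^{{\rm lifted},\rho})\leq{\rm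 var}_{\lambda}(f,P^{{\rm lifted},1-T_{v}}),\] where $P^{{\rm lifted},1-T_{v}}$ uses $\rho_{v,-v}(x)=1-T_{v}(x,\mathsf{X})$.
   Context: For a Markov kernel $P$ on $E$ leaving $\mu$ invariant, $\lambda\in[0,1)$, $f\in L^{2}(\mu)$ and $\bar f=f-\mu(f)$: ${\rm var}_{\lambda}(f,P)=\|\bar f\|_{\mu}^{2}+2\sum_{k\geq1}\lambda^{k}\langle\bar f,P^{k}\bar f\rangle_{\mu}$, with $\langle f,g\rangle_{\mu}=\int fg\,{\rm d}\mu$. *)

(* Defs.v *)
From HB Require Import structures.
From mathcomp Require Import all_boot all_order all_algebra.
From mathcomp Require Import all_classical all_reals all_analysis.
Set Implicit Arguments. Unset Strict Implicit. Unset Printing Implicit Defensive.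
Import Order.TTheory GRing.Theory Num.Theory.
Import numFieldNormedType.Exports.
Local Open Scope classical_set_scope.
Local Open Scope ring_scope.

(* Conventions: the state space E = X * {-1,1} is encoded as X * bool, with
   [true] standing for v = 1 and [false] for v = -1; hence -v is [~~ v].
   Functions on E are curried: [f : X -> bool -> R], f x v = f(x,v). *)

Section lifted.
Context d (X : measurableType d) (R : realType).
Variables (T1 Tm1 : R.-spker X ~> X).

Definition Tv (v : bool) : R.-spker X ~> X := if v then T1 else Tm1.

Definition mass (v : bool) (x : X) : R := fine (Tv v x setT).

(* switching rate rho_{v,-v}(x) = rho v x *)
Definition switching_rate (rho : bool -> X -> R) : Prop :=
  forall (x : X) (v : bool),
    0 <= rho v x <= 1 - mass v x /\
    rho v x - rho (~~ v) x = mass (~~ v) x - mass v x.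

Definition rho_tilde (v : bool) (x : X) : R :=
  Num.max 0 (mass (~~ v) x - mass v x).

Definition rho_max (v : bool) (x : X) : R := 1 - mass v x.

(* Action of the lifted kernel on functions:
   (P^{lifted,rho} f)(x,v) = \int P^{lifted,rho}((x,v); d(y,w)) f(y,w)
     = \int T_v(x,dy) f(y,v) + (1 - T_v(x,X) - rho_{v,-v}(x)) f(x,v)
       + rho_{v,-v}(x) f(x,-v). *)
Definition lifted (rho : bool -> X -> R) (f : X -> bool -> R) : X -> bool -> R :=
  fun x v => Rintegral (Tv v x) setT (fun y => f y v)
             + (1 - mass v x - rho v x) * f x v
             + rho v x * f x (~~ v).
End lifted.

Section variance.
Context d (X : measurableType d) (R : realType).
Variable pi : probability X R.

(* <g,h>_mu with mu(d(x,v)) = 1/2 pi(dx) I{v in {-1,1}} *)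
Definition inner_mu (g h : X -> bool -> R) : R :=
  2^-1 * (Rintegral pi setT (fun x => g x true * h x true)
          + Rintegral pi setT (fun x => g x false * h x false)).

Definition mean_mu (f : X -> bool -> R) : R := inner_mu f (fun _ _ => 1).

Definition center_mu (f : X -> bool -> R) : X -> bool -> R :=
  fun x v => f x v - mean_mu f.

(* var_lambda(f,P) = ||fbar||^2 + 2 sum_{k>=1} lambda^k <fbar, P^k fbar>,
   the series being the limit of its partial sums. P is given through its
   action on functions. *)
Definition var_lambda (lam : R) (P : (X -> bool -> R) -> (X -> bool -> R))
    (f : X -> bool -> R) : R :=
  let fb := center_mu f in
  inner_mu fb fb
  + 2 * limn (fun n : nat => \sum_(1 <= k < n.+1) lam ^+ k * inner_mu fb (iter k P fb)).
End variance.

(* Main.v *)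
(* The flip Q turns the lifted kernels into mu-self-adjoint operators QP, and
   two of them differ by P2 - P1 = (rho2 - rho1)(Q - 1), so that Q(P2 - P1) is
   nonnegative when rho1 <= rho2.  For f = Qf, the value <f, (1 - lam P)^-1 f>
   is the saddle value of the quadratic functional
     g |-> 2<f, g> - <Qg, (1 - lam P) g>,
   which is concave in the Q-symmetric part of g, because P is a contraction,
   and convex in its Q-antisymmetric part.  The functional increases with
   Q(P2 - P1), hence so does the saddle value.  Replacing the resolvent by the
   partial sums of its Neumann series costs an error O(lam^n) and avoids the
   completeness of L^2. *)

Require Import Defs.
From HB Require Import structures.
From mathcomp Require Import all_boot all_order all_algebra.
From mathcomp Require Import all_classical all_reals all_analysis.
From mathcomp Require Import measurable_realfun.
From mathcomp Require Import ring lra.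
Import Order.TTheory GRing.Theory Num.Theory.
Import numFieldNormedType.Exports.
Import HBNNSimple.
Local Open Scope classical_set_scope.
Local Open Scope ring_scope.

(** * Saddle-point comparison of Neumann series in an abstract semi-inner-product space *)

Section neumann.
Context (R : realType) (V : lmodType R) (S : V -> Prop) (ip : V -> V -> R).
Context (S_lin : forall a u w, S u -> S w -> S (a *: u + w))
  (ipC : forall u w, ip u w = ip w u)
  (ip_ge0 : forall u, S u -> 0 <= ip u u)
  (ip_lin : forall a u w z, S u -> S w -> S z ->
    ip (a *: u + w) z = a * ip u z + ip w z).
Context (Q : V -> V) (SQ : forall u, S u -> S (Q u))
  (Q_lin : forall a u w, Q (a *: u + w) = a *: Q u + Q w)
  (QK : forall u, Q (Q u) = u)
  (ipQ : forall u w, S u -> S w -> ip (Q u) (Q w) = ip u w).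

(** All clauses but stability constrain [P] through [ip] only: the action of a kernel, built from
    [Rintegral], is linear only almost everywhere. Self-adjointness of QP makes [ip (Q u) (P w)]
    linear in [w] as well. The last clause is contractivity in Young form, free of square roots;
    [u := P w] recovers the bound on norms. *)
Definition contractive_Q_adjoint (P : V -> V) :=
  [/\ forall u, S u -> S (P u),
      forall u w, S u -> S w -> ip (Q u) (P w) = ip (P u) (Q w) &
      forall u w, S u -> S w -> 2 * ip u (P w) <= ip u u + ip w w].

Let S0 u : S u -> S 0.
Proof. by move=> Su; rewrite -(addNr u) -scaleN1r; exact: S_lin. Qed.

Let SD u w : S u -> S w -> S (u + w).
Proof. by move=> Su Sw; rewrite -(scale1r u); exact: S_lin. Qed.

Let SZ a u : S u -> S (a *: u).
Proof.
by move=> Su; rewrite -(addr0 (_ *: _)); apply: S_lin => //; exact: S0 Su.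
Qed.

Let SB u w : S u -> S w -> S (u - w).
Proof. by move=> Su Sw; rewrite -scaleN1r; apply: SD => //; exact: SZ. Qed.

Let ipD u w z : S u -> S w -> S z -> ip (u + w) z = ip u z + ip w z.
Proof. by move=> *; rewrite -{1}(scale1r u) ip_lin// mul1r. Qed.

Let ipZ a u z : S u -> S z -> ip (a *: u) z = a * ip u z.
Proof.
move=> Su Sz; have S0' := S0 _ Su; rewrite -[X in ip X _]addr0 ip_lin//.
suff -> : ip 0 z = 0 by rewrite addr0.
by apply: (@addIr _ (ip 0 z)); rewrite add0r -ipD// addr0.
Qed.

Let ipB u w z : S u -> S w -> S z -> ip (u - w) z = ip u z - ip w z.
Proof. by move=> *; rewrite -scaleN1r ipD ?ipZ ?mulN1r//; exact: SZ. Qed.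

Let ipDr u w z : S u -> S w -> S z -> ip z (u + w) = ip z u + ip z w.
Proof. by move=> *; rewrite ipC ipD// ![ip _ z]ipC. Qed.

Let ipZr a u z : S u -> S z -> ip z (a *: u) = a * ip z u.
Proof. by move=> *; rewrite ipC ipZ// ipC. Qed.

Let QD u w : Q (u + w) = Q u + Q w.
Proof. by rewrite -{1}(scale1r u) Q_lin scale1r. Qed.

Let Q0 : Q 0 = 0.
Proof. by apply: (@addIr _ (Q 0)); rewrite -QD !add0r. Qed.

Let QZ a u : Q (a *: u) = a *: Q u.
Proof. by rewrite -{1}(addr0 (a *: u)) Q_lin Q0 addr0. Qed.

Let QB u w : Q (u - w) = Q u - Q w.
Proof. by rewrite -scaleN1r QD QZ scaleN1r. Qed.

(** Replaces Cauchy-Schwarz: positivity on [u + w] and [u - w] gives 2|<u, w>| <= <u, u> + <w,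
    w>. *)
Lemma ip_norm_le F u w : S u -> S w -> ip u u <= F -> ip w w <= F ->
  `|ip u w| <= F.
Proof.
move=> Su Sw uF wF; rewrite ler_norml.
have := ip_ge0 _ (SD _ _ Su Sw); have := ip_ge0 _ (SB _ _ Su Sw).
have Suw := SB _ _ Su Sw; have Suw' := SD _ _ Su Sw.
rewrite ipB// ipD// [ip u (u - w)]ipC [ip w (u - w)]ipC [ip u (u + w)]ipC.
rewrite [ip w (u + w)]ipC !ipB// !ipD// (ipC w u).
by move=> *; lra.
Qed.

Section kernel.
Context (P : V -> V) (PQ : contractive_Q_adjoint P).
Context (lam : R) (lam_ge0 : 0 <= lam) (lam_lt1 : lam < 1).
Context (f : V) (Sf : S f).

Let SP u : S u -> S (P u). Proof. by case: PQ => + _ _; exact. Qed.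

Lemma iter_stable k : S (iter k P f).
Proof. by elim: k => //= k; exact: SP. Qed.
Hint Resolve iter_stable : core.

Lemma ip_iter_le k : ip (iter k P f) (iter k P f) <= ip f f.
Proof.
case: PQ => _ _ H; elim: k => //= k IH; apply: le_trans _ IH.
have := H (P (iter k P f)) (iter k P f) (SP _ (iter_stable k)) (iter_stable k).
by move=> *; lra.
Qed.

Definition neumann_sum n : V := \sum_(k < n.+1) lam ^+ k *: iter k P f.

Lemma neumann_sumS n :
  neumann_sum n.+1 = lam ^+ n.+1 *: iter n.+1 P f + neumann_sum n.
Proof. by rewrite /neumann_sum big_ord_recr addrC. Qed.

Lemma neumann_sum0 : neumann_sum 0 = f.
Proof. by rewrite /neumann_sum big_ord1 expr0 scale1r. Qed.

Lemma neumann_sum_stable n : S (neumann_sum n).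
Proof.
elim: n => [|n IH]; first by rewrite neumann_sum0.
by rewrite neumann_sumS; exact: S_lin.
Qed.
Hint Resolve neumann_sum_stable : core.

Lemma ip_neumann_sum_le w n : S w -> ip w w <= ip f f ->
  `|ip (neumann_sum n) w| <= ip f f / (1 - lam).
Proof.
move=> Sw wF; set F := ip f f in wF *.
have F0 : 0 <= F by exact: ip_ge0.
have l1 : 0 < 1 - lam by move: lam_lt1; lra.
(* The induction needs the exact partial sum of the geometric series. *)
suff : `|ip (neumann_sum n) w| <= F * (1 - lam ^+ n.+1) / (1 - lam).
  move=> /le_trans; apply; rewrite ler_pM2r ?invr_gt0// ler_piMr//.
  by have := exprn_ge0 n.+1 lam_ge0; lra.
elim: n => [|n IH].
  by rewrite neumann_sum0 expr1 mulfK ?gt_eqF//; exact: ip_norm_le.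
rewrite neumann_sumS ip_lin// (le_trans (ler_normD _ _))//.
rewrite normrM ger0_norm ?exprn_ge0//.
have H : `|ip (iter n.+1 P f) w| <= F.
  by apply: ip_norm_le => //; exact: ip_iter_le.
have {}H := ler_wpM2l (exprn_ge0 n.+1 lam_ge0) H.
apply: le_trans (lerD H IH) _.
rewrite le_eqVlt; apply/orP; left; apply/eqP.
rewrite (exprS lam n.+1); field; lra.
Qed.

Definition resolvent_form u w := ip (Q u) w - lam * ip (Q u) (P w).

Lemma resolvent_formC u w : S u -> S w ->
  resolvent_form u w = resolvent_form w u.
Proof.
case: PQ => _ H _ Su Sw; rewrite /resolvent_form H//.
rewrite [ip (P u) _]ipC; congr (_ - _).
by rewrite -ipQ// ?QK; [exact: ipC|exact: SQ].
Qed.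

(** Linearity is proved in the first argument, on which only [Q] acts; [resolvent_formC] carries it
    over to the second, on which [P] acts. *)
Lemma resolvent_form_lin a u w z : S u -> S w -> S z ->
  resolvent_form (a *: u + w) z =
  a * resolvent_form u z + resolvent_form w z.
Proof.
move=> Su Sw Sz; rewrite /resolvent_form Q_lin !ip_lin//;
  try by [exact: SQ|exact: SP].
by ring.
Qed.

Lemma resolvent_formD u w z : S u -> S w -> S z ->
  resolvent_form (u + w) z = resolvent_form u z + resolvent_form w z.
Proof. by move=> *; rewrite -{1}(scale1r u) resolvent_form_lin// mul1r. Qed.

Lemma resolvent_form_sqrD u w : S u -> S w ->
  resolvent_form (u + w) (u + w) =
  resolvent_form u u + 2 * resolvent_form w u + resolvent_form w w.
Proof.
move=> Su Sw; have Suw := SD _ _ Su Sw.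
rewrite resolvent_formD// (resolvent_formC u)// (resolvent_formC w)//.
by rewrite !resolvent_formD// (resolvent_formC u w)//; ring.
Qed.

Let ip_contract u : S u -> lam * ip u (P u) <= ip u u.
Proof.
case: PQ => _ _ H Su.
have {}H : ip u (P u) <= ip u u by have := H _ _ Su Su; lra.
apply: le_trans (ler_wpM2l lam_ge0 H) _; exact: ler_piMl (ip_ge0 _ Su) (ltW lam_lt1).
Qed.

(** On symmetric vectors the form is <u, (1 - lam P) u>, on antisymmetric ones its opposite. These
    two signs make [saddle] concave in one direction and convex in the other. *)
Lemma resolvent_form_ge0 u : S u -> Q u = u -> 0 <= resolvent_form u u.
Proof. by move=> Su Qu; rewrite /resolvent_form Qu subr_ge0 ip_contract. Qed.

Lemma resolvent_form_le0 u : S u -> Q u = - u -> resolvent_form u u <= 0.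
Proof.
move=> Su Qu; rewrite /resolvent_form Qu -scaleN1r !ipZ//; last exact: SP.
by have := ip_contract _ Su; lra.
Qed.

(** Applying 1 - lam P to the truncated Neumann sum telescopes to f - lam^(n+1) P^(n+1) f; this is
    the defect, tested against [w]. *)
Definition remainder n w := lam ^+ n.+1 * ip w (iter n.+1 P f).

Lemma resolvent_form_neumann_sum n w : S w ->
  resolvent_form w (neumann_sum n) = ip (Q w) f - remainder n (Q w).
Proof.
move=> Sw; elim: n => [|n IH].
  by rewrite neumann_sum0 /resolvent_form /remainder expr1.
rewrite neumann_sumS resolvent_formC//; last exact: S_lin.
rewrite resolvent_form_lin// -resolvent_formC// -(resolvent_formC w)// IH.
by rewrite /resolvent_form /remainder (exprS lam n.+1) /=; ring.
Qed.

Definition saddle u := 2 * ip f u - resolvent_form u u.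

Context (f_Q : forall w, S w -> ip (Q w) f = ip w f).

Lemma saddle_neumann_sum n :
  saddle (neumann_sum n) = ip f (neumann_sum n) + remainder n (Q (neumann_sum n)).
Proof. by rewrite /saddle resolvent_form_neumann_sum// f_Q// (ipC _ f); ring. Qed.

(** The Neumann sum is a critical point of [saddle] up to the defect: the first-order term in [w]
    reduces to a [remainder]. *)
Lemma saddle_neumann_sumD n w : S w ->
  saddle (neumann_sum n + w) =
  saddle (neumann_sum n) + 2 * remainder n (Q w) - resolvent_form w w.
Proof.
move=> Sw; rewrite /saddle resolvent_form_sqrD// resolvent_form_neumann_sum//.
rewrite resolvent_form_neumann_sum// !f_Q//.
by rewrite ipDr// (ipC w f); ring.
Qed.

End kernel.

Section compare.
Context (P1 P2 : V -> V) (PQ1 : contractive_Q_adjoint P1)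
  (PQ2 : contractive_Q_adjoint P2).
Context (P_le : forall u, S u -> ip (Q u) (P1 u) <= ip (Q u) (P2 u)).
Context (lam : R) (lam_ge0 : 0 <= lam) (lam_lt1 : lam < 1).
Context (f : V) (Sf : S f) (f_Q : forall w, S w -> ip (Q w) f = ip w f).

(** The boolean [e], read as 0 or 1 by [iter], treats a Neumann sum and its flip together. [P] and
    [P'] may differ because the defect of one kernel gets tested against the sum of the other. *)
Let remainder_bound P P' m n (e : bool) : contractive_Q_adjoint P ->
  contractive_Q_adjoint P' ->
  `|remainder P lam f n (iter e Q (neumann_sum P' lam f m))| <=
  lam ^+ n.+1 * (ip f f / (1 - lam)).
Proof.
move=> PQ PQ'; set g := neumann_sum _ _ _ _.
rewrite /remainder normrM ger0_norm ?exprn_ge0//.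
apply: ler_wpM2l; first exact: exprn_ge0.
have Sg : S g by exact: neumann_sum_stable.
have SI := iter_stable P PQ f Sf n.+1.
have HI := ip_iter_le P PQ f Sf n.+1.
case: e; last exact: ip_neumann_sum_le.
(* As [Q] is an isometric involution, it moves from the Neumann sum to the iterate. *)
rewrite -{1}(QK (iter n.+1 P f)) ipQ//; last exact: SQ.
by apply: ip_neumann_sum_le => //; [exact: SQ | rewrite ipQ].
Qed.

(* The two saddle values are compared through [g1 + a = g2 + s], which
   has the symmetric part of [g1] and the antisymmetric part of [g2]. *)
Lemma neumann_sum_le n :
  ip f (neumann_sum P1 lam f n) <= ip f (neumann_sum P2 lam f n) +
  10 * (lam ^+ n.+1 * (ip f f / (1 - lam))).
Proof.
set g1 := neumann_sum P1 lam f n; set g2 := neumann_sum P2 lam f n.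
set c := lam ^+ _ * _.
have Sg1 : S g1 by exact: neumann_sum_stable.
have Sg2 : S g2 by exact: neumann_sum_stable.
have SQg1 := SQ _ Sg1; have SQg2 := SQ _ Sg2.
pose t := g1 - g2; have St : S t by exact: SB.
have SQt := SQ _ St.
(* [s] is the symmetric part of [g1 - g2] and [a] is minus its antisymmetric part. *)
pose s := 2^-1 *: (t + Q t); pose a := 2^-1 *: (Q t - t).
have Ss : S s by apply: SZ; exact: SD.
have Sa : S a by apply: SZ; exact: SB.
have Qs : Q s = s by rewrite /s QZ QD QK [X in _ *: X]addrC.
have Qa : Q a = - a by rewrite /a QZ QB QK -scalerN opprB.
have sa : s - a = t.
  rewrite /s /a -scalerBr opprB addrACA subrr addr0 -mulr2n.
  by rewrite -(scaler_nat 2 t) scalerA mulVf ?pnatr_eq0// scale1r.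
have h12 : g1 + a = g2 + s.
  by rewrite -(subrK a s) sa addrA /t [g2 + _]addrC subrK.
have E2 := saddle_neumann_sumD P2 PQ2 lam f Sf f_Q n s Ss.
have E1 := saddle_neumann_sumD P1 PQ1 lam f Sf f_Q n a Sa.
have G2 := saddle_neumann_sum P2 PQ2 lam f Sf f_Q n.
have G1 := saddle_neumann_sum P1 PQ1 lam f Sf f_Q n.
rewrite -/g1 -/g2 in E1 E2 G1 G2.
(* Up to remainders, adding [a] to [g1] can only raise the functional of [P1], and adding [s] to
   [g2] can only lower that of [P2]. At the common point [P_le] compares the two functionals. *)
have B2 := resolvent_form_ge0 P2 PQ2 lam lam_ge0 lam_lt1 s Ss Qs.
have B1 := resolvent_form_le0 P1 PQ1 lam lam_ge0 lam_lt1 a Sa Qa.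
have L12 : saddle P1 lam f (g1 + a) <= saddle P2 lam f (g2 + s).
  rewrite -h12 /saddle /resolvent_form; have Sh := SD _ _ Sg1 Sa.
  by have := ler_wpM2l lam_ge0 (P_le _ Sh); lra.
have bd P P' e (HP : contractive_Q_adjoint P) (HP' : contractive_Q_adjoint P') :=
  remainder_bound P P' n n e HP HP'.
have rB P (HP : contractive_Q_adjoint P) u w : S u -> S w ->
    remainder P lam f n (u - w) = remainder P lam f n u - remainder P lam f n w.
  by move=> *; rewrite /remainder ipB ?mulrBr//; exact: iter_stable.
have rD P (HP : contractive_Q_adjoint P) u w : S u -> S w ->
    remainder P lam f n (u + w) = remainder P lam f n u + remainder P lam f n w.
  by move=> *; rewrite /remainder ipD ?mulrDr//; exact: iter_stable.
have rZ P (HP : contractive_Q_adjoint P) b u : S u ->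
    remainder P lam f n (b *: u) = b * remainder P lam f n u.
  by move=> *; rewrite /remainder ipZ 1?mulrCA//; exact: iter_stable.
have rt P (HP : contractive_Q_adjoint P) : remainder P lam f n t =
    remainder P lam f n g1 - remainder P lam f n g2 by rewrite -rB.
have rQt P (HP : contractive_Q_adjoint P) : remainder P lam f n (Q t) =
    remainder P lam f n (Q g1) - remainder P lam f n (Q g2) by rewrite -rB// -QB.
rewrite Qs {2}/s rZ ?(rD _ PQ2 t (Q t)) ?rt ?rQt// in E2; last exact: SD.
have Qa' : Q a = 2^-1 *: (t - Q t) by rewrite /a QZ QB QK.
rewrite Qa' rZ ?(rB _ PQ1 t (Q t)) ?rt ?rQt// in E1; last exact: SB.
(* The factor 10 counts remainders of size at most [c]: one in each of [G1] and [G2], and four in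
   each of [E1] and [E2], where twice a remainder at [Q a] or [s] expands over [g1], [g2] and their
   flips. *)
move: (bd P1 P1 true PQ1 PQ1) (bd P1 P2 true PQ1 PQ2).
move: (bd P1 P1 false PQ1 PQ1) (bd P1 P2 false PQ1 PQ2).
move: (bd P2 P1 true PQ2 PQ1) (bd P2 P2 true PQ2 PQ2).
move: (bd P2 P1 false PQ2 PQ1) (bd P2 P2 false PQ2 PQ2).
rewrite /= -/g1 -/g2 -/c !ler_norml.
by move=> *; lra.
Qed.

(** Has the shape of [var_lambda] with [f] already centred, so that the two unify in the
    application. *)
Definition asymptotic_variance (P : V -> V) : R :=
  ip f f + 2 * limn (fun n : nat =>
    \sum_(1 <= k < n.+1) lam ^+ k * ip f (iter k P f)).

Let series_eq P (PQ : contractive_Q_adjoint P) n :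
  \sum_(1 <= k < n.+1) lam ^+ k * ip f (iter k P f) =
  ip f (neumann_sum P lam f n) - ip f f.
Proof.
have SI := iter_stable P PQ f Sf.
elim: n => [|n IH]; first by rewrite big_geq// neumann_sum0 subrr.
have Sn := neumann_sum_stable P PQ lam f Sf n.
have Sn1 := SI n.+1.
rewrite big_nat_recr//= IH neumann_sumS ipDr ?ipZr//; first by ring.
exact: SZ.
Qed.

Let is_cvg_series P (PQ : contractive_Q_adjoint P) : cvgn (fun n : nat =>
    \sum_(1 <= k < n.+1) lam ^+ k * ip f (iter k P f)).
Proof.
have SI := iter_stable P PQ f Sf.
have F0 : 0 <= ip f f by exact: ip_ge0.
pose u k := lam ^+ k * ip f (iter k P f).
have : cvgn (series u).
  apply: normed_cvg; apply: (@series_le_cvg _ _ (geometric (ip f f) lam)).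
  - by move=> k /=; exact: normr_ge0.
  - by move=> k /=; rewrite mulr_ge0// exprn_ge0.
  - move=> k; rewrite /u /geometric /= normrM ger0_norm ?exprn_ge0// mulrC.
    apply: ler_wpM2r; first exact: exprn_ge0.
    by apply: ip_norm_le => //; exact: ip_iter_le.
  - by apply: is_cvg_geometric_series; rewrite ger0_norm.
move=> /cvg_ex[l ul]; apply/cvg_ex; exists (l - u 0).
(* [series u n.+1] runs over k = 0, ..., n, while the sum in the variance starts at k = 1. *)
rewrite (_ : (fun _ => _) = (fun n => series u n.+1 - u 0)).
  by apply: cvgB; [rewrite cvg_shiftS|exact: cvg_cst].
apply/funext => n; rewrite seriesEnat /= [in RHS]big_nat_recl//.
by rewrite big_add1 /= addrAC subrr add0r.
Qed.

Lemma asymptotic_variance_le :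
  asymptotic_variance P1 <= asymptotic_variance P2.
Proof.
rewrite /asymptotic_variance lerD2l ler_pM2l//.
have c1 := is_cvg_series P1 PQ1; have c2 := is_cvg_series P2 PQ2.
(* [v n] is the error term of [neumann_sum_le]. It tends to 0, so adding it to the [P2] series keeps
   the limit and makes a termwise comparison possible. *)
pose v := geometric (10 * (lam * (ip f f / (1 - lam)))) lam.
have cv : v n @[n --> \oo] --> 0 by apply: cvg_geometric; rewrite ger0_norm.
have -> : limn (fun n => \sum_(1 <= k < n.+1) lam ^+ k * ip f (iter k P2 f)) =
    limn (fun n => \sum_(1 <= k < n.+1) lam ^+ k * ip f (iter k P2 f) + v n).
  apply/esym/cvg_lim => //; rewrite -[X in _ --> X]addr0.
  exact: cvgD.
apply: ler_lim => //; first by apply: is_cvgD => //; apply/cvg_ex; exists 0.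
near=> n; rewrite !series_eq// addrAC lerD2r.
apply: le_trans (neumann_sum_le n) _.
rewrite lerD2l /v /geometric /= exprS le_eqVlt; apply/orP; left; apply/eqP.
ring.
Unshelve. all: by end_near. Qed.

End compare.
End neumann.

(** * From sets to nonnegative measurable functions *)

Lemma ge0_measurable_ind d (X : measurableType d) (R : realType)
    (P : (X -> \bar R) -> Prop) :
  (forall A, measurable A -> P (fun x => (\1_A x)%:E)) ->
  (forall (a : R) (f : X -> \bar R), (0 <= a)%R -> measurable_fun setT f ->
    (forall x, 0 <= f x)%E -> P f -> P (fun x => a%:E * f x)%E) ->
  (forall f g : X -> \bar R, measurable_fun setT f -> (forall x, 0 <= f x)%E ->
    measurable_fun setT g -> (forall x, 0 <= g x)%E ->
    P f -> P g -> P (fun x => f x + g x)%E) ->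
  (forall F : nat -> X -> \bar R, (forall n, measurable_fun setT (F n)) ->
    (forall n x, 0 <= F n x)%E ->
    (forall x, {homo F^~ x : n m / (n <= m)%N >-> (n <= m)%E}) ->
    (forall n, P (F n)) -> P (fun x => limn (F^~ x))) ->
  forall f : X -> \bar R, measurable_fun setT f -> (forall x, 0 <= f x)%E -> P f.
Proof.
move=> P1 PZ PD Plim f mf f0; pose h := nnsfun_approx measurableT mf.
have -> : f = fun x => limn (fun n => (h n x)%:E).
  by apply/funext => x; apply/esym/cvg_lim => //; exact: cvg_nnsfun_approx.
apply: (Plim (fun n x => (h n x)%:E)).
- by move=> n; exact/measurable_EFinP.
- by move=> n x; rewrite lee_fin.
- by move=> x m n mn; rewrite lee_fin; exact/lefP/nd_nnsfun_approx.
move=> n; move: (h n) => {}h.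
have -> : (fun x => (h x)%:E) =
  (fun x => \sum_(r <- finmap.enum_fset (fset_set (range h)))
    (r * \1_(h @^-1` [set r]) x)%:E)%E.
  by apply/funext => x; rewrite fimfunE fsbig_finite//= sumEFin.
have mr (r : R) : measurable_fun setT
    (fun x => (r * \1_(h @^-1` [set r]) x)%:E).
  by apply/measurable_EFinP; apply: measurable_funM => //;
    exact: measurable_indic.
have r0 (r : R) x : (0 <= (r * \1_(h @^-1` [set r]) x)%:E)%E.
  by rewrite lee_fin; exact: nnfun_muleindic_ge0.
elim: (finmap.enum_fset _) => [|r s IH].
  have := P1 set0 measurable0; congr P; apply/funext => x.
  by rewrite big_nil indic0.
rewrite (_ : (fun _ => _) = (fun x => (r * \1_(h @^-1` [set r]) x)%:E +
   \sum_(j <- s) (j * \1_(h @^-1` [set j]) x)%:E)%E); last first.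
  by apply/funext => x; rewrite big_cons.
apply: PD => //.
- exact: emeasurable_sum.
- by move=> x; exact: sume_ge0.
(* The induction runs over arbitrary lists of reals, so [r] may be negative; its preimage under the
   nonnegative [h] is then empty. *)
have [r_ge0|r_lt0] := leP 0 r.
  have mi : measurable_fun setT (fun x => (\1_(h @^-1` [set r]) x)%:E : \bar R).
    exact/measurable_EFinP/measurable_indic.
  by apply: (PZ r _ r_ge0 mi) => [x|]; [rewrite lee_fin|exact: P1].
have := P1 set0 measurable0; congr P; apply/funext => x.
by rewrite preimage_nnfun0// indic0 mulr0.
Qed.

(** The delicate case is an infinite [c]. If the supremum is nonzero the product of limits is
    determinate; if it is 0, every [u n] is 0 and infinity times 0 is 0 on both sides. *)
Lemma nondecreasing_limeMl (R : realType) (c : \bar R) (u : nat -> \bar R) :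
  (0 <= c)%E -> (forall n, 0 <= u n)%E ->
  {homo u : n m / (n <= m)%N >-> (n <= m)%E} ->
  limn (fun n => c * u n)%E = (c * limn u)%E.
Proof.
move=> c0 u0 nd_u; have cu := ereal_nondecreasing_cvgn nd_u.
rewrite [in RHS](cvg_lim _ cu)//; apply/cvg_lim => //.
have [cfin|cinfty] := boolP (c \is a fin_num); first exact: cvgeZl.
have [supu0|supu0] := eqVneq (ereal_sup (range u)) 0%E; last first.
  by apply: cvgeM => //; [exact: mule_def_infty_neq0|exact: cvg_cst].
rewrite supu0 mule0 (_ : (fun _ => _) = cst 0%E); first exact: cvg_cst.
apply/funext => n; suff -> : u n = 0%E by rewrite mule0.
apply/eqP; rewrite eq_le u0 andbT -supu0.
by apply: ereal_sup_ubound; exists n.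
Qed.

(** The weights are extended-valued so that an inner integral can serve as one, and the kernels are
    bare measurable families so that Dirac masses qualify; [ge0_adjoint] uses both. *)
Lemma ge0_integral_mixture_ext d (X : measurableType d) (R : realType)
    (mu : {measure set X -> \bar R})
    (K1 K2 : X -> {measure set X -> \bar R}) (c1 c2 : X -> \bar R) :
  (forall A, measurable A -> measurable_fun setT (K1 ^~ A)) ->
  (forall A, measurable A -> measurable_fun setT (K2 ^~ A)) ->
  measurable_fun setT c1 -> measurable_fun setT c2 ->
  (forall x, 0 <= c1 x)%E -> (forall x, 0 <= c2 x)%E ->
  (forall A, measurable A ->
    \int[mu]_x (c1 x * K1 x A) = \int[mu]_x (c2 x * K2 x A))%E ->
  forall f : X -> \bar R, measurable_fun setT f -> (forall x, 0 <= f x)%E ->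
  (\int[mu]_x (c1 x * \int[K1 x]_y f y) =
   \int[mu]_x (c2 x * \int[K2 x]_y f y))%E.
Proof.
move=> mK1 mK2 mc1 mc2 c10 c20 c12.
have mF (c : X -> \bar R) (K : X -> {measure set X -> \bar R}) (f : X -> \bar R) :
    (forall A, measurable A -> measurable_fun setT (K ^~ A)) ->
    measurable_fun setT c -> measurable_fun setT f -> (forall x, 0 <= f x)%E ->
    measurable_fun setT (fun x => c x * \int[K x]_y f y)%E.
  by move=> mK mc mf f0; apply: emeasurable_funM; [exact: mc|
    exact: measurable_fun_integral_kernel].
have F0 (c : X -> \bar R) (K : X -> {measure set X -> \bar R}) (f : X -> \bar R) :
    (forall x, 0 <= c x)%E ->
    (forall x, 0 <= f x)%E -> forall x, (0 <= c x * \int[K x]_y f y)%E.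
  by move=> c0 f0 x; apply: mule_ge0 => //; exact: integral_ge0.
apply: ge0_measurable_ind.
- move=> A mA; under eq_integral do rewrite integral_indic// setIT.
  by under [RHS]eq_integral do rewrite integral_indic// setIT; exact: c12.
- move=> a f a0 mf f0 IH.
  under eq_integral do rewrite ge0_integralZl_EFin// muleCA.
  under [RHS]eq_integral do rewrite ge0_integralZl_EFin// muleCA.
  by rewrite !ge0_integralZl_EFin ?IH//; try by [move=> x _; exact: F0|exact: mF].
- move=> f g mf f0 mg g0 IHf IHg.
  under eq_integral do rewrite ge0_integralD// ge0_muleDr ?integral_ge0//.
  under [RHS]eq_integral do rewrite ge0_integralD// ge0_muleDr ?integral_ge0//.
  by rewrite !ge0_integralD ?IHf ?IHg//; try by [move=> x _; exact: F0|exact: mF].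
- move=> F mFn Fn0 ndF IH.
  have key (c : X -> \bar R) (K : X -> {measure set X -> \bar R}) :
    (forall A, measurable A -> measurable_fun setT (K ^~ A)) ->
    measurable_fun setT c -> (forall x, 0 <= c x)%E ->
    (\int[mu]_x (c x * \int[K x]_y limn (F^~ y)) =
     limn (fun n => \int[mu]_x (c x * \int[K x]_y F n y)))%E.
    move=> mK mc c0; rewrite -monotone_convergence//.
    + apply: eq_integral => x _; rewrite monotone_convergence//.
      apply/esym/nondecreasing_limeMl => // n; first exact: integral_ge0.
      by move=> m mn; apply: ge0_le_integral => // y _; exact: ndF.
    + by move=> n; exact: mF.
    + by move=> n x _; exact: F0.
    + move=> x _ m n mn; apply: lee_wpmul2l => //.
      by apply: ge0_le_integral => // y _; exact: ndF.
  rewrite (key _ _ mK1 mc1 c10) (key _ _ mK2 mc2 c20); congr (limn _).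
  by apply/funext => n; exact: IH.
Qed.

(** * Kernels in duality with respect to [pi], on nonnegative functions *)

Section adjoint.
Context {d} {X : measurableType d} {R : realType} (pi : probability X R).

Definition reversal (T T' : R.-spker X ~> X) :=
  forall A B : set X, measurable A -> measurable B ->
  (\int[pi]_(x in A) T x B = \int[pi]_(y in B) T' y A)%E.

Lemma reversalC T T' : reversal T T' -> reversal T' T.
Proof. by move=> TT' A B mA mB; rewrite TT'. Qed.

Lemma sprob_fin_num (K : R.-spker X ~> X) x A : measurable A ->
  K x A \is a fin_num.
Proof.
move=> mA; rewrite ge0_fin_numE//; apply: le_lt_trans (ltry 1).
apply: le_trans (sprob_kernel_le1 K x).
by apply: le_measure; rewrite ?inE.
Qed.

Lemma measurable_sprob_fine (K : R.-spker X ~> X) A : measurable A ->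
  measurable_fun setT (fun x => fine (K x A)).
Proof.
by move=> mA; apply: measurableT_comp => //; exact: measurable_kernel.
Qed.

(** Reversal on rectangles is extended one factor at a time: [step1] replaces the indicator of A by
    [u], then a second application replaces that of B by [w]. The side carrying no kernel integral
    at that stage is written as a mixture of Dirac masses. *)
Lemma ge0_adjoint T T' (u w : X -> R) : reversal T T' -> measurable_fun setT u ->
  measurable_fun setT w -> (forall x, 0 <= u x) -> (forall x, 0 <= w x) ->
  (\int[pi]_x ((u x)%:E * \int[T x]_y (w y)%:E) =
   \int[pi]_y ((w y)%:E * \int[T' y]_x (u x)%:E))%E.
Proof.
move=> rev mu mw u0 w0.
pose delta := (fun x => dirac x) : X -> {measure set X -> \bar R}.
have mdelta A : measurable A -> measurable_fun setT (delta ^~ A).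
  by move=> mA; exact: measurable_fun_dirac.
have deltaE (f : X -> \bar R) x : measurable_fun setT f ->
    (\int[delta x]_y f y = f x)%E.
  by move=> mf; rewrite integral_dirac// diracT mul1e.
have mK (K : R.-spker X ~> X) A : measurable A -> measurable_fun setT (K ^~ A).
  by move=> mA; exact: measurable_kernel.
have mu' : measurable_fun setT (EFin \o u) by exact/measurable_EFinP.
have mw' : measurable_fun setT (EFin \o w) by exact/measurable_EFinP.
have mI (B : set X) : measurable B ->
    measurable_fun setT (fun x => (\1_B x)%:E : \bar R).
  by move=> mB; exact/measurable_EFinP/measurable_indic.
have u0' x : (0 <= (EFin \o u) x)%E by rewrite lee_fin.
have w0' x : (0 <= (EFin \o w) x)%E by rewrite lee_fin.
have I0 (B : set X) x : (0 <= (\1_B x)%:E :> \bar R)%E by rewrite lee_fin.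
have intI (B : set X) (f : X -> \bar R) :
    (\int[pi]_x ((\1_B x)%:E * f x) = \int[pi]_(x in B) f x)%E.
  rewrite [RHS]integral_mkcond; apply: eq_integral => x _.
  by rewrite patchE indicE; case: ifPn => _; rewrite ?mul1e ?mul0e.
have step1 B : measurable B ->
    (\int[pi]_x ((u x)%:E * T x B) =
     \int[pi]_y ((\1_B y)%:E * \int[T' y]_x (u x)%:E))%E.
  move=> mB.
  have := @ge0_integral_mixture_ext _ X R pi delta T' (T ^~ B)
    (fun x => (\1_B x)%:E) mdelta (mK T') (mK T _ mB) (mI _ mB)
    (fun x => measure_ge0 _ _) (I0 B) _ _ mu' u0'.
  under eq_integral do rewrite deltaE// muleC.
  apply => A mA; rewrite intI -rev// -intI.
  by apply: eq_integral => x _; rewrite muleC /delta/= diracE indicE.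
have mT'u : measurable_fun setT (fun y => \int[T' y]_x (u x)%:E)%E.
  by apply: measurable_fun_integral_kernel => //; exact: mK.
have := @ge0_integral_mixture_ext _ X R pi T delta (EFin \o u)
  (fun y => \int[T' y]_x (u x)%:E)%E (mK T) mdelta mu' mT'u u0'
  (fun y => integral_ge0 _ (fun x _ => u0' x)) _ _ mw' w0'.
under [X in (_ -> _ = X) -> _]eq_integral do rewrite deltaE// muleC.
apply => A mA; rewrite step1//.
by apply: eq_integral => x _; rewrite muleC /delta/= diracE indicE.
Qed.

End adjoint.

(** * Square-integrable functions, as genuine functions rather than classes *)

Section square_integrable.
Context {d} {X : measurableType d} {R : realType}.
Context (mu : {finite_measure set X -> \bar R}).

Implicit Types (u w z b : X -> R) (a : R).

Definition L2 (u : X -> R) := measurable_fun setT u /\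
  mu.-integrable setT (fun x => (u x ^+ 2)%:E).

Definition ip (u w : X -> R) : R := \int[mu]_x (u x * w x).

Lemma L2_le u w : measurable_fun setT u -> L2 w ->
  (forall x, u x ^+ 2 <= w x ^+ 2) -> L2 u.
Proof.
move=> m_u [mw iw] uw; split => //.
apply: (le_integrable measurableT _ _ iw).
  exact/measurable_EFinP/measurable_funX.
by move=> x _; rewrite !gee0_abs ?lee_fin ?sqr_ge0.
Qed.

Lemma L2M u w : L2 u -> L2 w -> mu.-integrable setT (EFin \o (fun x => u x * w x)).
Proof.
move=> [m_u iu] [mw iw].
apply: (le_integrable measurableT _ _ (integrableD measurableT iu iw)).
  exact/measurable_EFinP/measurable_funM.
move=> x _ /=; rewrite lee_fin [leRHS]ger0_norm ?addr_ge0 ?sqr_ge0//.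
by rewrite ler_norml; have := sqr_ge0 (u x + w x); have := sqr_ge0 (u x - w x); nra.
Qed.

Lemma L2_cst (c : R) : L2 (fun=> c).
Proof.
split; first exact: measurable_cst.
exact: finite_measure_integrable_cst.
Qed.

Lemma L2_lin a u w : L2 u -> L2 w -> L2 (fun x => a * u x + w x).
Proof.
move=> Lu Lw; have [m_u iu] := Lu; have [mw iw] := Lw; split.
  by apply: measurable_funD => //; apply: measurable_funM.
have i1 := integrableZl measurableT (a ^+ 2) iu.
have i2 := integrableZl measurableT (2 * a) (L2M _ _ Lu Lw).
have := integrableD measurableT (integrableD measurableT i1 i2) iw.
congr (_.-integrable _ _); apply/funext => x /=.
by rewrite -!EFinM -!EFinD; congr EFin; ring.
Qed.

Lemma L2D u w : L2 u -> L2 w -> L2 (fun x => u x + w x).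
Proof.
move=> Lu Lw; have := L2_lin 1 _ _ Lu Lw.
by congr L2; apply/funext => x; rewrite mul1r.
Qed.

Lemma L2_bounded b u : measurable_fun setT b -> (forall x, 0 <= b x <= 1) ->
  L2 u -> L2 (fun x => b x * u x).
Proof.
move=> mb b01 Lu; apply: (L2_le _ u) => //.
  by case: Lu => *; exact: measurable_funM.
by move=> x; have := b01 x; rewrite exprMn => *; rewrite ler_piMl ?sqr_ge0//; nra.
Qed.

Lemma ipC u w : ip u w = ip w u.
Proof. by apply: eq_Rintegral => x _; rewrite mulrC. Qed.

Lemma ip_ge0 u : 0 <= ip u u.
Proof. by apply: Rintegral_ge0 => x _; rewrite -expr2 sqr_ge0. Qed.

Lemma ip_lin a u w z : L2 u -> L2 w -> L2 z ->
  ip (fun x => a * u x + w x) z = a * ip u z + ip w z.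
Proof.
move=> Lu Lw Lz; have i1 := L2M _ _ Lu Lz; have i2 := L2M _ _ Lw Lz.
rewrite /ip -RintegralZl// -RintegralD//;
  last exact: (integrableZl measurableT a i1).
by apply: eq_Rintegral => x _; ring.
Qed.

Lemma ipD u w z : L2 u -> L2 w -> L2 z ->
  ip (fun x => u x + w x) z = ip u z + ip w z.
Proof.
move=> *; rewrite -[ip u z]mul1r -ip_lin//.
by apply: eq_Rintegral => x _; rewrite mul1r.
Qed.

Lemma ip_ae u w z : measurable_fun setT u -> measurable_fun setT w ->
  measurable_fun setT z ->
  {ae mu, forall x, u x = w x} -> ip u z = ip w z.
Proof.
move=> m_u mw mz uw; congr fine; apply: ae_eq_integral => //.
- by apply/measurable_EFinP; exact: measurable_funM.
- by apply/measurable_EFinP; exact: measurable_funM.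
by move: uw; apply: filterS => x /= -> _.
Qed.

End square_integrable.

(** * Young and Jensen inequalities for a measure of mass at most one *)

Section subprobability.
Context {d} {X : measurableType d} {R : realType}.
Context (nu : {measure set X -> \bar R}).
Context (nu1 : (nu setT <= 1)%E).

Lemma subprob_integrable (g : X -> R) : measurable_fun setT g ->
  (\int[nu]_y (g y ^+ 2)%:E < +oo)%E -> nu.-integrable setT (EFin \o g).
Proof.
move=> mg g2.
have ig2 : nu.-integrable setT (fun y => (g y ^+ 2)%:E).
  apply/integrableP; split; first exact/measurable_EFinP/measurable_funX.
  by under eq_integral do rewrite gee0_abs ?lee_fin ?sqr_ge0//.
have i1 : nu.-integrable setT (cst 1%:E).
  apply/integrableP; split; first exact: measurable_cst.
  under eq_integral do rewrite /= normr1.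
  by rewrite integral_cst// mul1e; exact: le_lt_trans nu1 (ltry _).
apply: (le_integrable measurableT _ _ (integrableD measurableT i1 ig2)).
  exact/measurable_EFinP.
move=> x _ /=; rewrite lee_fin [leRHS]ger0_norm ?addr_ge0 ?sqr_ge0//.
rewrite ler_norml.
by have := sqr_ge0 (g x + 1); have := sqr_ge0 (g x - 1); nra.
Qed.

(* Young's inequality under the integral, [0 <= \int (g - z)^2]; it holds
   trivially when [g] is not square integrable. *)
Lemma subprob_young (g : X -> R) (z : R) : measurable_fun setT g ->
  ((2 * (z * \int[nu]_y g y))%:E <=
   (z ^+ 2 * fine (nu setT))%:E + \int[nu]_y (g y ^+ 2)%:E)%E.
Proof.
move=> mg; have m2 : measurable_fun setT (fun y => (g y ^+ 2)%:E : \bar R).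
  exact/measurable_EFinP/measurable_funX.
have [g2|] := ltP (\int[nu]_y (g y ^+ 2)%:E)%E +oo%E; last first.
  by rewrite leye_eq => /eqP ->; rewrite addey// leey.
have ig := subprob_integrable _ mg g2.
have ig2 : nu.-integrable setT (EFin \o (fun y => g y ^+ 2)).
  apply/integrableP; split => //.
  by under eq_integral do rewrite /= ger0_norm ?sqr_ge0//.
have nufin : nu setT \is a fin_num.
  by rewrite ge0_fin_numE//; exact: le_lt_trans nu1 (ltry _).
have iz : nu.-integrable setT (EFin \o cst (z ^+ 2)).
  apply/integrableP; split; first exact/measurable_EFinP.
  under eq_integral do rewrite /= ger0_norm ?sqr_ge0//.
  by rewrite integral_cst// -(fineK nufin) -EFinM ltry.
rewrite -[X in (_ + X)%E](fineK (integrable_fin_num measurableT ig2)).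
rewrite -EFinD lee_fin -[fine (integral _ _ _)]/(\int[nu]_y (g y ^+ 2)).
rewrite -(Rintegral_cst nu measurableT) -RintegralD//.
rewrite mulrA -RintegralZl//; apply: le_Rintegral => //.
- exact: (integrableZl measurableT _ ig).
- exact: (integrableD measurableT iz ig2).
by move=> y _ /=; have := sqr_ge0 (g y - z); nra.
Qed.

(** Jensen's inequality, from [subprob_young] at z = \int g: the term z^2 nu(X) is at most z^2. *)
Lemma subprob_sqr_le (g : X -> R) : measurable_fun setT g ->
  (((\int[nu]_y g y) ^+ 2)%:E <= \int[nu]_y (g y ^+ 2)%:E)%E.
Proof.
move=> mg; have := subprob_young g (\int[nu]_y g y) mg.
have [g2|] := ltP (\int[nu]_y (g y ^+ 2)%:E)%E +oo%E; last first.
  by rewrite leye_eq => /eqP -> _; rewrite leey.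
have fin : (\int[nu]_y (g y ^+ 2)%:E)%E \is a fin_num.
  rewrite ge0_fin_numE//; apply: integral_ge0 => y _.
  by rewrite lee_fin sqr_ge0.
have nufin : nu setT \is a fin_num.
  by rewrite ge0_fin_numE//; exact: le_lt_trans nu1 (ltry _).
rewrite -(fineK fin) -EFinD !lee_fin; have : fine (nu setT) <= 1.
  by rewrite -lee_fin fineK.
set z := Rintegral _ _ _ => m1; have := sqr_ge0 z; nra.
Qed.

End subprobability.

(** * Sub-stochastic kernels as operators on L^2 *)

Section kernel_operator.
Context {d} {X : measurableType d} {R : realType} (pi : probability X R).
Implicit Types (K T : R.-spker X ~> X) (u w g : X -> R).

Definition kop K g : X -> R := fun x => \int[K x]_y g y.

Lemma measurable_kop K g : measurable_fun setT g -> measurable_fun setT (kop K g).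
Proof.
move=> mg; apply: measurableT_comp => //.
have mE : measurable_fun setT (EFin \o g) by exact/measurable_EFinP.
rewrite (_ : (fun _ => _) = (fun x => \int[K x]_y (EFin \o g)^\+ y -
    \int[K x]_y (EFin \o g)^\- y)%E); last first.
  by apply/funext => x; rewrite integralE.
have mK A : measurable A -> measurable_fun setT (K ^~ A).
  by move=> mA; exact: measurable_kernel.
by apply: emeasurable_funB; apply: measurable_fun_integral_kernel => //;
  [exact: measurable_funepos|exact: measurable_funeneg].
Qed.

(** Duality against the constant 1, since T' sends 1 to T'(y, X). The integrand is bracketed as in
    [ip]. *)
Lemma integral_kernel_sqr T T' g : reversal pi T T' -> measurable_fun setT g ->
  (\int[pi]_x \int[T x]_y (g y ^+ 2)%:E =
   \int[pi]_y ((fine (T' y setT) * g y) * g y)%:E)%E.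
Proof.
move=> TT' mg.
have := ge0_adjoint pi T T' (fun=> 1) (fun y => g y ^+ 2) TT'
  (measurable_cst _) (measurable_funX 2 mg) (fun=> ler01) (fun y => sqr_ge0 _).
under eq_integral do rewrite mul1e.
move=> ->; apply: eq_integral => y _; rewrite integral_cst// mul1e.
rewrite -{1}(fineK (sprob_fin_num T' y setT measurableT)) -EFinM.
by congr EFin; ring.
Qed.

Lemma mass_bound K x : 0 <= fine (K x setT) <= 1.
Proof.
rewrite fine_ge0//= -lee_fin fineK ?sprob_fin_num//.
exact: sprob_kernel_le1.
Qed.

Lemma integrable_kernel_sqr T T' g : reversal pi T T' -> L2 pi g ->
  pi.-integrable setT (fun x => \int[T x]_y (g y ^+ 2)%:E)%E.
Proof.
move=> TT' Lg; have [mg _] := Lg; apply/integrableP; split.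
  apply: measurable_fun_integral_kernel.
  - by move=> A mA; exact: measurable_kernel.
  - by move=> y; rewrite lee_fin sqr_ge0.
  - exact/measurable_EFinP/measurable_funX.
have G0 x : (0 <= \int[T x]_y (g y ^+ 2)%:E)%E.
  by apply: integral_ge0 => y _; rewrite lee_fin sqr_ge0.
under eq_integral do rewrite gee0_abs//.
rewrite (integral_kernel_sqr T T')//.
have mT : measurable_fun setT (fun y => fine (T' y setT)).
  exact: measurable_sprob_fine.
have Lm := L2_bounded pi _ _ mT (mass_bound T') Lg.
have := integrable_fin_num measurableT (L2M pi _ _ Lm Lg).
by rewrite fin_numElt => /andP[].
Qed.

Lemma L2_kop T T' g : reversal pi T T' -> L2 pi g -> L2 pi (kop T g).
Proof.
move=> TT' Lg; have [mg _] := Lg; have mk := measurable_kop T g mg; split => //.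
apply: (le_integrable measurableT _ _ (integrable_kernel_sqr T T' g TT' Lg)).
  exact/measurable_EFinP/measurable_funX.
move=> x _; rewrite !gee0_abs ?lee_fin ?sqr_ge0//; last first.
  by apply: integral_ge0 => y _; rewrite lee_fin sqr_ge0.
by apply: subprob_sqr_le => //; exact: sprob_kernel_le1.
Qed.

(** T(g^2) is [pi]-integrable, hence finite almost everywhere. Only at such points is [kop T] known
    to be additive, as [Rintegral] takes a default value on a non-integrable function. *)
Lemma ae_kernel_integrable T T' g : reversal pi T T' -> L2 pi g ->
  {ae pi, forall x, (T x).-integrable setT (EFin \o g)}.
Proof.
move=> TT' Lg; have [mg _] := Lg.
have := integrable_ae measurableT (integrable_kernel_sqr T T' g TT' Lg).
apply: filterS => x /(_ I); rewrite fin_numElt => /andP[_ g2].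
by apply: subprob_integrable => //; exact: sprob_kernel_le1.
Qed.

(** Integrates [subprob_young] for T(x, .) with z = u(x). Reversal turns the integral of T(g^2) into
    the mass of T', hence two different masses on the right. *)
Lemma kop_young T T' u g : reversal pi T T' -> L2 pi u -> L2 pi g ->
  2 * ip pi u (kop T g) <=
  ip pi (fun x => fine (T x setT) * u x) u +
  ip pi (fun x => fine (T' x setT) * g x) g.
Proof.
move=> TT' Lu Lg; have [mg _] := Lg; have Lk := L2_kop T T' g TT' Lg.
have Lm K w : L2 pi w -> L2 pi (fun x => fine (K x setT) * w x).
  by move=> Lw; apply: L2_bounded Lw; [exact: measurable_sprob_fine|
    exact: mass_bound].
have i1 := integrableZl measurableT 2 (L2M pi _ _ Lu Lk).
have i2 := L2M pi _ _ (Lm T _ Lu) Lu.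
have i3 := integrable_kernel_sqr T T' g TT' Lg.
have i4 := L2M pi _ _ (Lm T' _ Lg) Lg.
rewrite -lee_fin EFinD /ip -RintegralZl//; last exact: L2M.
have EFinR f : pi.-integrable setT (EFin \o f) ->
    ((\int[pi]_x f x)%:E = \int[pi]_x (f x)%:E)%E.
  by move=> fi; rewrite fineK//; exact: integrable_fin_num.
rewrite !EFinR// -(integral_kernel_sqr T T' g TT' mg) -integralD//.
apply: le_integral => //; first exact: integrableD.
move=> x _; have := subprob_young (T x) (sprob_kernel_le1 T x) g (u x) mg.
by move=> /le_trans; apply; rewrite leeD2r// lee_fin; lra.
Qed.

Lemma ge0_ip_kop T T' u w : reversal pi T T' -> L2 pi u -> L2 pi w ->
  (forall x, 0 <= u x) -> (forall x, 0 <= w x) ->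
  ip pi u (kop T w) = fine (\int[pi]_x ((u x)%:E * \int[T x]_y (w y)%:E))%E.
Proof.
move=> TT' Lu Lw u0 w0; have [m_u _] := Lu; have [mw _] := Lw.
congr fine; apply: ae_eq_integral => //.
- by apply/measurable_EFinP; apply: measurable_funM => //; exact: measurable_kop.
- apply: emeasurable_funM; first exact/measurable_EFinP.
  apply: measurable_fun_integral_kernel; last exact/measurable_EFinP.
  + by move=> A mA; exact: measurable_kernel.
  + by move=> y; rewrite lee_fin.
have := ae_kernel_integrable T T' w TT' Lw; apply: filterS => x ix _.
by rewrite EFinM /kop fineK//; exact: integrable_fin_num.
Qed.

Lemma L2_funrpos g : L2 pi g -> L2 pi g^\+.
Proof.
move=> Lg; apply: (L2_le pi _ g) => //.
  by case: Lg => ? _; exact: measurable_funrpos.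
by move=> x; rewrite /funrpos; have [_|] := leP (g x) 0; rewrite // expr0n sqr_ge0.
Qed.

Lemma L2_funrneg g : L2 pi g -> L2 pi g^\-.
Proof.
move=> Lg; rewrite -funrposN; apply: L2_funrpos.
have := L2_lin pi (- 1) g (fun=> 0) Lg (L2_cst pi 0).
by congr L2; apply/funext => x; rewrite addr0 mulN1r.
Qed.

(** Both functions are split into positive and negative parts; the four resulting pairings are
    nonnegative cases of [ge0_adjoint]. *)
Lemma ip_kop_adjoint T T' u w : reversal pi T T' -> L2 pi u -> L2 pi w ->
  ip pi u (kop T w) = ip pi (kop T' u) w.
Proof.
move=> TT' Lu Lw; have T'T := reversalC pi _ _ TT'.
(* The difference is written in the shape [a * u x + w x] expected by [ip_lin]. *)
have pn g : g = (fun x => -1 * g^\- x + g^\+ x).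
  by apply/funext => x; rewrite mulN1r addrC -[in LHS](funrposBneg g).
have kopB K K' g (KK' : reversal pi K K') : L2 pi g ->
    {ae pi, forall x, kop K g x = -1 * kop K g^\- x + kop K g^\+ x}.
  move=> Lg; have := ae_kernel_integrable K K' _ KK' (L2_funrpos _ Lg).
  have := ae_kernel_integrable K K' _ KK' (L2_funrneg _ Lg).
  apply: filterS2 => x in_ ip_; rewrite mulN1r addrC /kop -RintegralB//.
  by apply: eq_Rintegral => y _; rewrite -[in LHS](funrposBneg g).
have ipkop K K' g z (KK' : reversal pi K K') : L2 pi g -> L2 pi z ->
    ip pi (kop K g) z = -1 * ip pi (kop K g^\-) z + ip pi (kop K g^\+) z.
  move=> Lg Lz; have Lgp := L2_kop K K' _ KK' (L2_funrpos _ Lg).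
  have Lgn := L2_kop K K' _ KK' (L2_funrneg _ Lg).
  rewrite -ip_lin//; apply: ip_ae; last exact: kopB KK' Lg.
  - by case: (L2_kop K K' g KK' Lg).
  - by case: (L2_lin pi (-1) _ _ Lgn Lgp).
  - by case: Lz.
have ippn g z : L2 pi g -> L2 pi z ->
    ip pi g z = -1 * ip pi g^\- z + ip pi g^\+ z.
  by move=> Lg Lz; rewrite {1}(pn g) ip_lin//; [exact: L2_funrneg|exact: L2_funrpos].
have ge0_case g z : L2 pi g -> L2 pi z -> (forall x, 0 <= g x) ->
    (forall x, 0 <= z x) -> ip pi (kop T g) z = ip pi (kop T' z) g.
  move=> Lg Lz g0 z0; have [mg _] := Lg; have [mz _] := Lz.
  rewrite ipC (ge0_ip_kop T T')// (ipC _ _ g) (ge0_ip_kop T' T)//.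
  by rewrite (ge0_adjoint pi T T').
have expand K K' g z : reversal pi K K' -> L2 pi g -> L2 pi z ->
    ip pi (kop K g) z = ip pi (kop K g^\-) z^\- - ip pi (kop K g^\-) z^\+
      - ip pi (kop K g^\+) z^\- + ip pi (kop K g^\+) z^\+.
  move=> KK' Lg Lz; rewrite (ipkop K K')//.
  have Lkn := L2_kop K K' _ KK' (L2_funrneg _ Lg).
  have Lkp := L2_kop K K' _ KK' (L2_funrpos _ Lg).
  have H h : L2 pi h -> ip pi h z = -1 * ip pi h z^\- + ip pi h z^\+.
    by move=> Lh; rewrite ipC ippn// ![ip _ _ h]ipC.
  by rewrite (H _ Lkn) (H _ Lkp) !mulN1r opprD opprK !addrA.
have n0 := @funrneg_ge0 X R; have p0 := @funrpos_ge0 X R.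
have Lu1 := L2_funrpos _ Lu; have Lu2 := L2_funrneg _ Lu.
have Lw1 := L2_funrpos _ Lw; have Lw2 := L2_funrneg _ Lw.
rewrite ipC (expand T T' w u TT' Lw Lu) (expand T' T u w T'T Lu Lw).
rewrite (ge0_case _ _ Lw1 Lu1 (p0 _) (p0 _)) (ge0_case _ _ Lw1 Lu2 (p0 _) (n0 _)).
rewrite (ge0_case _ _ Lw2 Lu1 (n0 _) (p0 _)) (ge0_case _ _ Lw2 Lu2 (n0 _) (n0 _)).
by congr (_ + _); rewrite addrAC.
Qed.

End kernel_operator.

(** * The lifted kernel on L^2(mu): self-adjointness up to the flip, contractivity, monotonicity *)

Section lifted_kernel.
Context {d} {X : measurableType d} {R : realType} (pi : probability X R).
Context (T1 Tm1 : R.-spker X ~> X) (rev : reversal pi T1 Tm1).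
Implicit Types (g h : X -> bool -> R) (v w : bool)
  (b u : X -> R).

Local Notation m := (mass T1 Tm1).
Local Notation T := (Tv T1 Tm1).

Definition L2_lifted g := forall v, L2 pi (g ^~ v).

Definition flip g : X -> bool -> R := fun x v => g x (~~ v).

Lemma L2_lifted_lin (a : R) g h :
  L2_lifted g -> L2_lifted h -> L2_lifted (a *: g + h).
Proof. by move=> Lg Lh v; exact: L2_lin. Qed.

Lemma L2_lifted_flip g : L2_lifted g -> L2_lifted (flip g).
Proof. by move=> Lg v; exact: Lg. Qed.

Lemma inner_muE g h : inner_mu pi g h =
  2^-1 * (ip pi (g ^~ true) (h ^~ true) + ip pi (g ^~ false) (h ^~ false)).
Proof. by []. Qed.

Lemma inner_muC g h : inner_mu pi g h = inner_mu pi h g.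
Proof. by rewrite !inner_muE !(ipC _ (g ^~ _)). Qed.

Lemma inner_mu_ge0 g : 0 <= inner_mu pi g g.
Proof. by rewrite inner_muE mulr_ge0 ?invr_ge0// addr_ge0// ip_ge0. Qed.

Lemma inner_mu_lin (a : R) g h k : L2_lifted g -> L2_lifted h -> L2_lifted k ->
  inner_mu pi (a *: g + h) k = a * inner_mu pi g k + inner_mu pi h k.
Proof.
move=> Lg Lh Lk; rewrite !inner_muE.
have E v : ip pi ((a *: g + h) ^~ v) (k ^~ v) =
    a * ip pi (g ^~ v) (k ^~ v) + ip pi (h ^~ v) (k ^~ v) by exact: ip_lin.
by rewrite !E; ring.
Qed.

Lemma inner_mu_flip g h : inner_mu pi (flip g) (flip h) = inner_mu pi g h.
Proof. by rewrite !inner_muE addrC. Qed.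

Lemma reversal_Tv v : reversal pi (T v) (T (~~ v)).
Proof. by case: v => //=; exact: reversalC. Qed.

Lemma measurable_mass v : measurable_fun setT (m v).
Proof. exact: measurable_sprob_fine. Qed.

Lemma switching_rate_tilde : switching_rate T1 Tm1 (rho_tilde T1 Tm1).
Proof.
move=> x v; have := mass_bound (T v) x; have := mass_bound (T (~~ v)) x.
rewrite -!/(m _ x) /rho_tilde negbK => /andP[? ?] /andP[? ?].
by rewrite /Num.max; case: ltP => ?; case: ltP => ?; split;
  try (apply/andP; split); lra.
Qed.

Lemma switching_rate_max : switching_rate T1 Tm1 (rho_max T1 Tm1).
Proof.
move=> x v; have := mass_bound (T v) x; rewrite -/(m v x) => /andP[? ?].
by rewrite /rho_max lexx andbT; split; lra.
Qed.

Lemma measurable_rho_tilde v : measurable_fun setT (rho_tilde T1 Tm1 v).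
Proof.
apply: measurable_maxr; first exact: measurable_cst.
by apply: measurable_funB; exact: measurable_mass.
Qed.

Lemma measurable_rho_max v : measurable_fun setT (rho_max T1 Tm1 v).
Proof.
by apply: measurable_funB; [exact: measurable_cst|exact: measurable_mass].
Qed.

Lemma ip_mulC b u (w : X -> R) :
  ip pi (fun x => b x * u x) w = ip pi u (fun x => b x * w x).
Proof. by apply: eq_Rintegral => x _; ring. Qed.

Lemma ip_young b u (w : X -> R) :
  measurable_fun setT b -> (forall x, 0 <= b x <= 1) ->
  L2 pi u -> L2 pi w ->
  2 * ip pi u (fun x => b x * w x) <=
  ip pi (fun x => b x * u x) u + ip pi (fun x => b x * w x) w.
Proof.
move=> mb b01 Lu Lw.
have Lbu := L2_bounded pi b u mb b01 Lu; have Lbw := L2_bounded pi b w mb b01 Lw.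
have i1 := L2M pi _ _ Lu Lbw; have i2 := L2M pi _ _ Lbu Lu.
have i3 := L2M pi _ _ Lbw Lw.
rewrite /ip -RintegralZl// -RintegralD//; apply: le_Rintegral => //.
- exact: (integrableZl measurableT _ i1).
- exact: (integrableD measurableT i2 i3).
by move=> x _; have /andP[b0 _] := b01 x;
  have := mulr_ge0 b0 (sqr_ge0 (u x - w x)); nra.
Qed.

Section rate.
Context (rho : bool -> X -> R) (rho_sw : switching_rate T1 Tm1 rho).
Context (rho_meas : forall v, measurable_fun setT (rho v)).

Definition stay v x := 1 - m v x - rho v x.

Lemma rho_bound v x : 0 <= rho v x <= 1.
Proof.
have [/andP[? ?] _] := rho_sw x v; have := mass_bound (T v) x.
by rewrite -/(m v x) => /andP[? ?]; apply/andP; split; lra.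
Qed.

Lemma stay_bound v x : 0 <= stay v x <= 1.
Proof.
have [/andP[? ?] _] := rho_sw x v; have := mass_bound (T v) x.
by rewrite -/(m v x) /stay => /andP[? ?]; apply/andP; split; lra.
Qed.

(** A rearrangement of the identity defining a switching rate. It is what makes the holding part
    self-adjoint after the flip. *)
Lemma stayN v : stay (~~ v) = stay v.
Proof. by apply/funext => x; have [_] := rho_sw x v; rewrite /stay; lra. Qed.

Lemma measurable_stay v : measurable_fun setT (stay v).
Proof.
by apply: measurable_funB => //; apply: measurable_funB;
  [exact: measurable_cst|exact: measurable_mass].
Qed.

Lemma L2_stay g v w : L2_lifted g -> L2 pi (fun x => stay v x * g x w).
Proof.
by move=> Lg; apply: L2_bounded (Lg w); [exact: measurable_stay|exact: stay_bound].
Qed.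

Lemma L2_rho g v w : L2_lifted g -> L2 pi (fun x => rho v x * g x w).
Proof.
by move=> Lg; apply: L2_bounded (Lg w); [exact: rho_meas|exact: rho_bound].
Qed.

Lemma L2_kop_Tv g v : L2_lifted g -> L2 pi (kop (T v) (g ^~ v)).
Proof. by move=> Lg; exact: L2_kop (reversal_Tv v) (Lg v). Qed.

Lemma L2_lifted_lifted g : L2_lifted g -> L2_lifted (lifted T1 Tm1 rho g).
Proof.
move=> Lg v; apply: (L2D pi (fun x => _ + _)); last exact: L2_rho.
by apply: L2D; [exact: L2_kop_Tv|exact: L2_stay].
Qed.

Lemma ip_lifted g (u : X -> R) v : L2_lifted g -> L2 pi u ->
  ip pi u (lifted T1 Tm1 rho g ^~ v) = ip pi u (kop (T v) (g ^~ v)) +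
  ip pi u (fun x => stay v x * g x v) + ip pi u (fun x => rho v x * g x (~~ v)).
Proof.
move=> Lg Lu; have Lk := L2_kop_Tv g v Lg.
have Ls := L2_stay g v v Lg; have Lr := L2_rho g v (~~ v) Lg.
rewrite ipC (ipD pi (fun x => _ + _) _ _ (L2D pi _ _ Lk Ls) Lr Lu).
by rewrite (ipD pi _ _ _ Lk Ls Lu) !(ipC _ u).
Qed.

(** The moves are handled by reversal and the holding part by [stayN]; the switching part becomes,
    after the flip, multiplication by [rho], which is symmetric. *)
Lemma lifted_adjoint g h : L2_lifted g -> L2_lifted h ->
  inner_mu pi (flip g) (lifted T1 Tm1 rho h) =
  inner_mu pi (lifted T1 Tm1 rho g) (flip h).
Proof.
move=> Lg Lh; rewrite !inner_muE !(ipC pi (lifted _ _ _ _ ^~ _)).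
rewrite !ip_lifted//; try by [exact: Lg|exact: Lh].
have K v : ip pi (g ^~ (~~ v)) (kop (T v) (h ^~ v)) =
    ip pi (h ^~ v) (kop (T (~~ v)) (g ^~ (~~ v))).
  by rewrite (ip_kop_adjoint pi _ (T (~~ v)))//; [rewrite ipC|exact: reversal_Tv].
have A v : ip pi (g ^~ (~~ v)) (fun x => stay v x * h x v) =
    ip pi (h ^~ v) (fun x => stay (~~ v) x * g x (~~ v)).
  by rewrite -ip_mulC ipC stayN.
have B v : ip pi (g ^~ v) (fun x => rho (~~ v) x * h x v) =
    ip pi (h ^~ v) (fun x => rho (~~ v) x * g x v).
  by rewrite -ip_mulC ipC.
have [Kt Kf] := (K true, K false); have [At Af] := (A true, A false).
have [Bt Bf] := (B true, B false).
rewrite /flip /= in Kt Kf At Af Bt Bf *.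
(* Moves and holding exchange the two velocities while switching preserves them, so only the former
   are swapped back. *)
by rewrite Kt Kf At Af Bt Bf addrACA [in RHS]addrACA [X in _ * (X + _) = _]addrC.
Qed.

(** Splits 1 into the three weights at velocity [v]. The coordinate [w] is independent of [v]
    because Young's inequality leaves on [h] the mass of the opposite velocity. *)
Lemma ip_split g v w : L2_lifted g ->
  ip pi (g ^~ w) (g ^~ w) = ip pi (fun x => m v x * g x w) (g ^~ w) +
    ip pi (fun x => stay v x * g x w) (g ^~ w) +
    ip pi (fun x => rho v x * g x w) (g ^~ w).
Proof.
move=> Lg; have Ls := L2_stay g v w Lg; have Lr := L2_rho g v w Lg.
have Lm : L2 pi (fun x => m v x * g x w).
  by apply: L2_bounded (Lg w); [exact: measurable_mass|exact: mass_bound].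
rewrite -(ipD pi _ _ _ Lm Ls (Lg w)) -(ipD pi _ _ _ (L2D pi _ _ Lm Ls) Lr (Lg w)).
by apply: eq_Rintegral => x _; rewrite /stay; ring.
Qed.

(** Young's inequality is applied to each of the three parts. The weights on [g] add up to 1 because
    rows of the lifted kernel do, those on [h] because [mu] is invariant, which uses [stayN]. *)
Lemma lifted_young g h : L2_lifted g -> L2_lifted h ->
  2 * inner_mu pi g (lifted T1 Tm1 rho h) <= inner_mu pi g g + inner_mu pi h h.
Proof.
move=> Lg Lh; rewrite !inner_muE !ip_lifted//; try exact: Lg.
have K v : 2 * ip pi (g ^~ v) (kop (T v) (h ^~ v)) <=
    ip pi (fun x => m v x * g x v) (g ^~ v) +
    ip pi (fun x => m (~~ v) x * h x v) (h ^~ v).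
  exact: kop_young pi _ _ _ _ (reversal_Tv v) (Lg v) (Lh v).
have A v := ip_young _ _ _ (measurable_stay v) (stay_bound v) (Lg v) (Lh v).
have B v := ip_young _ _ _ (rho_meas v) (rho_bound v) (Lg v) (Lh (~~ v)).
rewrite (ip_split g true true Lg) (ip_split g false false Lg).
rewrite (ip_split h false true Lh) (ip_split h true false Lh).
rewrite (stayN true : stay false = stay true).
move: (K true) (K false) (A true) (A false) (B true) (B false) => /=.
rewrite (stayN true : stay false = stay true).
by lra.
Qed.

End rate.

(** The terms in [T v] cancel. At each x the increment rho2 - rho1 is the same for both velocities
    and the holding weight drops by it, so the integrands differ by (rho2 - rho1) (g(x,1) -
    g(x,-1))^2. *)
Lemma lifted_monotone rho1 rho2 : switching_rate T1 Tm1 rho1 ->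
  (forall v, measurable_fun setT (rho1 v)) ->
  switching_rate T1 Tm1 rho2 -> (forall v, measurable_fun setT (rho2 v)) ->
  (forall v x, rho1 v x <= rho2 v x) ->
  forall g, L2_lifted g ->
  inner_mu pi (flip g) (lifted T1 Tm1 rho1 g) <=
  inner_mu pi (flip g) (lifted T1 Tm1 rho2 g).
Proof.
move=> sw1 m1 sw2 m2 rho12 g Lg; rewrite !inner_muE.
have Lf v : L2 pi (flip g ^~ v) by exact: Lg.
rewrite !(ip_lifted rho1)// !(ip_lifted rho2)// ler_pM2l ?invr_gt0//.
pose F rho v x := flip g x v * (stay rho v x * g x v) +
  flip g x v * (rho v x * g x (~~ v)).
have iF rho v (sw : switching_rate T1 Tm1 rho) :
    (forall v, measurable_fun setT (rho v)) ->
    pi.-integrable setT (EFin \o F rho v) /\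
    ip pi (flip g ^~ v) (kop (T v) (g ^~ v)) +
    ip pi (flip g ^~ v) (fun x => stay rho v x * g x v) +
    ip pi (flip g ^~ v) (fun x => rho v x * g x (~~ v)) =
    ip pi (flip g ^~ v) (kop (T v) (g ^~ v)) + \int[pi]_x F rho v x.
  move=> mr; have i1 := L2M pi _ _ (Lf v) (L2_stay rho sw mr g v v Lg).
  have i2 := L2M pi _ _ (Lf v) (L2_rho rho sw mr g v (~~ v) Lg).
  split; first exact: (integrableD measurableT i1 i2).
  by rewrite -addrA -RintegralD.
have [it1 ->] := iF _ true sw1 m1; have [if1 ->] := iF _ false sw1 m1.
have [it2 ->] := iF _ true sw2 m2; have [if2 ->] := iF _ false sw2 m2.
rewrite addrACA [leRHS]addrACA lerD2l -!RintegralD//.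
apply: le_Rintegral => //.
- exact: (integrableD measurableT it1 if1).
- exact: (integrableD measurableT it2 if2).
move=> x _; rewrite /F /flip /stay /=.
have := mulr_ge0 (_ : 0 <= rho2 true x - rho1 true x)
  (sqr_ge0 (g x true - g x false)).
rewrite subr_ge0 => /(_ (rho12 true x)).
have [_ /=] := sw1 x true; have [_ /=] := sw2 x true => e2 e1.
have -> : rho1 false x = rho1 true x - (m false x - m true x) by lra.
have -> : rho2 false x = rho2 true x - (m false x - m true x) by lra.
by nra.
Qed.

Lemma L2_lifted_center g : L2_lifted g -> L2_lifted (center_mu pi g).
Proof. by move=> Lg v; apply: L2D (Lg v) (L2_cst pi _). Qed.

(** Invariance under the flip holds only almost everywhere, so it enters the abstract argument
    through inner products, not as [flip h = h]. *)
Lemma inner_mu_flip_sym g h : L2_lifted g -> L2_lifted h ->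
  {ae pi, forall x, h x false = h x true} ->
  inner_mu pi (flip g) h = inner_mu pi g h.
Proof.
move=> Lg Lh hQ; rewrite !inner_muE addrC.
have mL k v : L2_lifted k -> measurable_fun setT (k ^~ v) by move=> /(_ v)[].
have E v : ip pi (h ^~ false) (g ^~ v) = ip pi (h ^~ true) (g ^~ v).
  by apply: ip_ae; try exact: mL.
congr (_ * (_ + _)).
  by rewrite -[LHS]/(ip pi (g ^~ true) (h ^~ false)) ipC E ipC.
by rewrite -[LHS]/(ip pi (g ^~ false) (h ^~ true)) ipC -E ipC.
Qed.

Lemma var_lambda_lifted_le rho1 rho2 : switching_rate T1 Tm1 rho1 ->
  (forall v, measurable_fun setT (rho1 v)) ->
  switching_rate T1 Tm1 rho2 -> (forall v, measurable_fun setT (rho2 v)) ->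
  (forall v x, rho1 v x <= rho2 v x) ->
  forall lam : R, 0 <= lam -> lam < 1 ->
  forall f, L2_lifted f -> {ae pi, forall x, f x false = f x true} ->
  var_lambda pi lam (lifted T1 Tm1 rho1) f <=
  var_lambda pi lam (lifted T1 Tm1 rho2) f.
Proof.
move=> sw1 m1 sw2 m2 rho12 lam lam0 lam1 f Lf fQ.
have Lfb := L2_lifted_center f Lf.
have fbQ : {ae pi, forall x, center_mu pi f x false = center_mu pi f x true}.
  by move: fQ; apply: filterS => x; rewrite /center_mu => ->.
have CA rho : switching_rate T1 Tm1 rho ->
    (forall v, measurable_fun setT (rho v)) ->
    @contractive_Q_adjoint R (X -> bool -> R) L2_lifted (inner_mu pi) flip
      (lifted T1 Tm1 rho).
  move=> sw mr; split.
  - exact: L2_lifted_lifted.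
  - exact: lifted_adjoint.
  - exact: lifted_young.
apply: (@asymptotic_variance_le R (X -> bool -> R) L2_lifted (inner_mu pi)
  L2_lifted_lin inner_muC (fun g _ => inner_mu_ge0 g) inner_mu_lin flip
  L2_lifted_flip _ _ (fun g h _ _ => inner_mu_flip g h)) => //.
- by move=> g; apply/funext => x; apply/funext => v; rewrite /flip negbK.
- exact: CA.
- exact: CA.
- exact: lifted_monotone.
- by move=> g Lg; exact: inner_mu_flip_sym.
Qed.

End lifted_kernel.

Theorem theorem3p15 (d : measure_display) (X : measurableType d) (R : realType)
    (pi : probability X R) (T1 Tm1 : R.-spker X ~> X)
    (rev : forall A B : set X, measurable A -> measurable B ->
       (\int[pi]_(x in A) T1 x B = \int[pi]_(y in B) Tm1 y A)%E)
    (rho : bool -> X -> R)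
    (rho_sw : switching_rate T1 Tm1 rho)
    (rho_meas : forall v, measurable_fun setT (rho v))
    (f : X -> bool -> R)
    (f_meas : forall v, measurable_fun setT (fun x => f x v))
    (f_L2 : forall v, pi.-integrable setT (fun x => ((f x v) ^+ 2)%:E))
    (f_Q : {ae pi, forall x, f x (~~ true) = f x true})
    (lam : R) (lam_ge0 : 0 <= lam) (lam_lt1 : lam < 1) :
  var_lambda pi lam (lifted T1 Tm1 (rho_tilde T1 Tm1)) f
    <= var_lambda pi lam (lifted T1 Tm1 rho) f
  /\ var_lambda pi lam (lifted T1 Tm1 rho) f
    <= var_lambda pi lam (lifted T1 Tm1 (rho_max T1 Tm1)) f.
Proof.
have Lf : L2_lifted pi f by move=> v; split.
split; apply: var_lambda_lifted_le => //.
- exact: switching_rate_tilde.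
- exact: measurable_rho_tilde.
(* [rho v x] is nonnegative and exceeds the difference of masses by [rho (~~ v) x], also
   nonnegative; hence it dominates their maximum. *)
- move=> v x; rewrite /rho_tilde ge_max.
  have [/andP[-> _] /= <-] := rho_sw x v.
  by have [/andP[r0 _] _] := rho_sw x (~~ v); rewrite gerBl.
- exact: switching_rate_max.
- exact: measurable_rho_max.
- by move=> v x; have [/andP[]] := rho_sw x v.
Qed.
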